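(* Let $\Lambda'=\mathbb{Z}[t^{\pm1},s^{\pm1},a^{\pm1},b^{\pm1}]/(s+t-a-b)$ and let $X$ be a $\Lambda'$-module. The operations $$x\,\underline{\triangleright}\,y=tx+(s-t)y,\qquad x\,\overline{\triangleright}\,y=sx,\qquad x\,\underline{\bullet}\,y=ax+(s-a)y,\qquad x\,\overline{\bullet}\,y=bx+(s-b)y$$ make $X$ a pI-adequate psyquandle (called an Alexander psyquandle).
   Context: **Biquandles.** A biquandle is a set $X$ with operations $\underline{\triangleright},\overline{\triangleright}:X\times X\to X$ such that (i) $x\,\underline{\triangleright}\,x=x\,\overline{\triangleright}\,x$ for all $x$; (ii) for all $y\in X$ the maps $\alpha_y(x)=x\,\overline{\triangleright}\,y$ and $\beta_y(x)=x\,\underline{\triangleright}\,y$ from $X$ to $X$ are invertible, and the map $S:X\times X\to X\times X$, $S(x,y)=(y\,\overline{\triangleright}\,x,\;x\,\underline{\triangleright}\,y)$, is invertible; (iii) for all $x,y,z$: $(x\underline{\triangleright}y)\underline{\triangleright}(z\underline{\triangleright}y)=(x\underline{\triangleright}z)\underline{\triangleright}(y\overline{\triangleright}z)$, $(x\underline{\triangleright}y)\overline{\triangleright}(z\underline{\triangleright}y)=(x\overline{\triangleright}z)\underline{\triangleright}(y\overline{\triangleright}z)$, $(x\overline{\triangleright}y)\overline{\triangleright}(z\overline{\triangleright}y)=(x\overline{\triangleright}z)\overline{\triangleright}(y\underline{\triangleright}z)$. **Psyquandles.** A psyquandle is a biquandle $X$ with two more operations $\underline{\bullet},\overline{\bullet}:X\times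 X\to X$ such that (p/si) for all $y\in X$ the maps $\alpha'_y(x)=x\,\overline{\bullet}\,y$ and $\beta'_y(x)=x\,\underline{\bullet}\,y$ are invertible, and $S'(x,y)=(y\,\overline{\bullet}\,x,\;x\,\underline{\bullet}\,y)$ is an invertible map $X\times X\to X\times X$; (p/sii) for all $x,y\in X$ there exist unique $w,z\in X$ with $x\underline{\triangleright}y=z\overline{\bullet}y$, $y\overline{\triangleright}x=w\overline{\bullet}x$, $w\underline{\triangleright}z=y\underline{\bullet}z$, $z\overline{\triangleright}w=x\underline{\bullet}w$; (p/siii) for all $x,y,z\in X$: $(x\overline{\triangleright}y)\overline{\triangleright}(z\overline{\bullet}y)=(x\overline{\triangleright}z)\overline{\triangleright}(y\underline{\bullet}z)$, $(x\underline{\triangleright}y)\underline{\triangleright}(z\overline{\bullet}y)=(x\underline{\triangleright}z)\underline{\triangleright}(y\underline{\bullet}z)$, $(x\overline{\triangleright}y)\overline{\bullet}(z\overline{\triangleright}y)=(x\overline{\bullet}z)\overline{\triangleright}(y\underline{\triangleright}z)$, $(x\underline{\triangleright}y)\underline{\bullet}(z\underline{\triangleright}y)=(x\underline{\bullet}z)\underline{\triangleright}(y\overline{\triangleright}z)$, $(x\overline{\triangleright}y)\underline{\bullet}(z\overline{\triangleright}y)=(x\underline{\bullet}z)\overline{\triangleright}(y\underline{\triangleright}z)$, $(x\underline{\triangleright}y)\overline{\bullet}(z\underline{\triangleright}y)=(x\overline{\bullet}z)\underline{\triangleright}(y\overline{\triangleright}z)$. It is pI-adequate if moreover $x\,\underline{\bullet}\,x=x\,\overline{\bullet}\,x$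 for all $x\in X$. *)

(* Defs.v *)
From HB Require Import structures.
From mathcomp Require Import all_boot all_order all_algebra.
From mathcomp Require Import ring_quotient.
From mathcomp.multinomials Require Import mpoly.
From mathcomp Require Import boolp.

Set Implicit Arguments.
Unset Strict Implicit.
Unset Printing Implicit Defensive.

Import GRing.Theory.
Local Open Scope ring_scope.
Local Open Scope quotient_scope.

Section Psyquandles.
Variable X : Type.

(* [ut], [ot], [ub], [ob] stand for the under-triangle, over-triangle,
   under-bullet and over-bullet operations; [ut x y] is the operation applied
   to x on the left and y on the right. *)
Record is_biquandle (ut ot : X -> X -> X) : Prop := IsBiquandle {
  biquandle_diag : forall x, ut x x = ot x x;
  biquandle_bij_ot : forall y, bijective (fun x => ot x y);
  biquandle_bij_ut : forall y, bijective (fun x => ut x y);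
  biquandle_bij_S :
    bijective (fun p : X * X => (ot p.2 p.1, ut p.1 p.2));
  biquandle_exchange1 : forall x y z,
    ut (ut x y) (ut z y) = ut (ut x z) (ot y z);
  biquandle_exchange2 : forall x y z,
    ot (ut x y) (ut z y) = ut (ot x z) (ot y z);
  biquandle_exchange3 : forall x y z,
    ot (ot x y) (ot z y) = ot (ot x z) (ut y z)
}.

Record is_psyquandle (ut ot ub ob : X -> X -> X) : Prop := IsPsyquandle {
  psyquandle_biquandle : is_biquandle ut ot;
  psyquandle_bij_ob : forall y, bijective (fun x => ob x y);
  psyquandle_bij_ub : forall y, bijective (fun x => ub x y);
  psyquandle_bij_S' :
    bijective (fun p : X * X => (ob p.2 p.1, ub p.1 p.2));
  (* uniqueness is that of the pair (w, z) = (p.1, p.2) *)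
  psyquandle_wz : forall x y, exists! p : X * X,
    [/\ ut x y = ob p.2 y, ot y x = ob p.1 x,
        ut p.1 p.2 = ub y p.2 & ot p.2 p.1 = ub x p.1];
  psyquandle_exchange1 : forall x y z,
    ot (ot x y) (ob z y) = ot (ot x z) (ub y z);
  psyquandle_exchange2 : forall x y z,
    ut (ut x y) (ob z y) = ut (ut x z) (ub y z);
  psyquandle_exchange3 : forall x y z,
    ob (ot x y) (ot z y) = ot (ob x z) (ut y z);
  psyquandle_exchange4 : forall x y z,
    ub (ut x y) (ut z y) = ut (ub x z) (ot y z);
  psyquandle_exchange5 : forall x y z,
    ub (ot x y) (ot z y) = ot (ub x z) (ut y z);
  psyquandle_exchange6 : forall x y z,
    ob (ut x y) (ut z y) = ut (ob x z) (ot y z)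
}.

Record is_pI_adequate_psyquandle (ut ot ub ob : X -> X -> X) : Prop :=
  IsPIAdequatePsyquandle {
  pI_adequate_psyquandle : is_psyquandle ut ot ub ob;
  pI_adequate_diag : forall x, ub x x = ob x x
}.

End Psyquandles.

(* The Laurent polynomial ring Z[t^+-1, s^+-1, a^+-1, b^+-1], realised as the
   subring of the field of rational functions in 4 variables consisting of the
   quotients of a polynomial by a monomial. *)
Definition laurent_pred : pred {fraction {mpoly int[4]}} :=
  fun u => `[< exists (p : {mpoly int[4]}) (m : 'X_{1..4}),
                 u = tofrac p / tofrac 'X_[m] >].

Lemma tofrac_monom_neq0 (m : 'X_{1..4}) :
  tofrac ('X_[m] : {mpoly int[4]}) != 0.
Proof.
rewrite tofrac_eq0; apply/eqP => /(congr1 (mcoeff m)).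
by rewrite mcoeffX eqxx mcoeff0 => /eqP; rewrite oner_eq0.
Qed.

Lemma laurent_subring_closed : subring_closed laurent_pred.
Proof.
split.
- apply/asboolP; exists 1, 0%MM.
  by rewrite mpolyX0 tofrac1 divr1.
- move=> u v /asboolP[p [m ->]] /asboolP[q [n ->]]; apply/asboolP.
  exists (p * 'X_[n] - q * 'X_[m]), (m + n)%MM.
  rewrite -mulNr addf_div ?tofrac_monom_neq0 //.
  by rewrite mpolyXD tofracM tofracB !tofracM mulNr.
- move=> u v /asboolP[p [m ->]] /asboolP[q [n ->]]; apply/asboolP.
  exists (p * q), (m + n)%MM.
  by rewrite mulf_div mpolyXD !tofracM.
Qed.

HB.instance Definition _ := GRing.isSubringClosed.Build
  {fraction {mpoly int[4]}} laurent_pred laurent_subring_closed.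

Record laurent := Laurent {
  laurent_val :> {fraction {mpoly int[4]}};
  laurent_valP : laurent_val \in laurent_pred
}.

HB.instance Definition _ := [isSub for laurent_val].
HB.instance Definition _ := [Choice of laurent by <:].
HB.instance Definition _ :=
  [SubChoice_isSubComNzRing of laurent by <:].

Lemma laurent_var_subproof (i : 'I_4) : tofrac 'X_i \in laurent_pred.
Proof. by apply/asboolP; exists 'X_i, 0%MM; rewrite mpolyX0 tofrac1 divr1. Qed.

Definition laurent_var (i : 'I_4) : laurent := Laurent (laurent_var_subproof i).

Definition laurent_t := laurent_var (inord 0).
Definition laurent_s := laurent_var (inord 1).
Definition laurent_a := laurent_var (inord 2).
Definition laurent_b := laurent_var (inord 3).

(* The principal ideal (s + t - a - b). *)
Definition alexander_ideal : pred laurent :=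
  fun u => `[< exists v : laurent,
    u = v * (laurent_s + laurent_t - laurent_a - laurent_b) >].

Lemma alexander_ideal_closed : idealr_closed alexander_ideal.
Proof.
split.
- by apply/asboolP; exists 0; rewrite mul0r.
- apply/asboolPn => -[v].
  move/(congr1 val).
  have /asboolP[p [m vE]] := laurent_valP v.
  rewrite rmorph1 rmorphM !rmorphB rmorphD /= vE -tofracD -!tofracB.
  rewrite mulrAC -tofracM => /esym/(canRL (divfK (tofrac_monom_neq0 m))).
  rewrite mul1r => /eqP; rewrite tofrac_eq => /eqP.
  move/(congr1 (meval (fun=> 1))).
  rewrite mevalM !mevalB mevalD !mevalXU mevalX big1 => [|i _]; last first.
    exact: expr1n.
  by rewrite -addrA -opprD subrr mulr0.
- move=> c u v /asboolP[x ->] /asboolP[y ->]; apply/asboolP.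
  by exists (c * x + y); rewrite mulrA mulrDl.
Qed.

HB.instance Definition _ := isIdealr.Build laurent alexander_ideal
  alexander_ideal_closed.

(* Lambda' = Z[t^+-1, s^+-1, a^+-1, b^+-1] / (s + t - a - b). *)
Definition alexander_idealr : idealr laurent := alexander_ideal.
Definition alexander_ring : comNzRingType := {ideal_quot alexander_idealr}.

Definition alexander_proj (u : laurent) : alexander_ring :=
  \pi_{ideal_quot alexander_idealr} u.
Definition alex_t : alexander_ring := alexander_proj laurent_t.
Definition alex_s : alexander_ring := alexander_proj laurent_s.
Definition alex_a : alexander_ring := alexander_proj laurent_a.
Definition alex_b : alexander_ring := alexander_proj laurent_b.

Lemma alexander_relation : alex_s + alex_t = alex_a + alex_b.
Proof.
apply/eqP; rewrite -subr_eq0 opprD addrA; apply/eqP.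
rewrite /alex_s /alex_t /alex_a /alex_b /alexander_proj.
rewrite -rmorphD -!rmorphB /=; apply/eqP.
rewrite -(rmorph0 \pi_{ideal_quot alexander_idealr}) -Quotient.idealrBE subr0.
by apply/asboolP; exists 1; rewrite mul1r.
Qed.

Lemma alexander_var_inv (i : 'I_4) :
  exists v : alexander_ring, v * alexander_proj (laurent_var i) = 1.
Proof.
have Vin : (tofrac 'X_i)^-1 \in laurent_pred.
  by apply/asboolP; exists 1, U_(i)%MM; rewrite tofrac1 div1r.
exists (alexander_proj (Laurent Vin)).
rewrite /alexander_proj -rmorphM /= -(rmorph1 \pi_{ideal_quot alexander_idealr}).
congr (\pi _); apply: val_inj; rewrite rmorphM rmorph1 /=.
by rewrite mulVf ?tofrac_monom_neq0.
Qed.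

(* Main.v *)
Require Import Defs.
From mathcomp Require Import all_boot all_algebra.
From mathcomp Require Import boolp ring.

(** Every operation has the form [x * y = u *: x + v *: y] with [u] invertible
    and [u + v = s], the over-triangle being the case [u = s], [v = 0].  Hence
    each axiom is an identity between coefficients, and it holds over any
    commutative ring in which [t], [s], [a], [b] are invertible and satisfy
    [s + t = a + b].

    - An exchange law compares two linear combinations of three vectors, that
      is, three pairs of coefficients ([linop_exchange]).
    - The maps [S] and [S'] on pairs are invertible when their determinants are
      ([bijective_linop_pair]).  Up to sign the determinant is [s * t] for [S],
      and [a * b - (s - a) * (s - b) = s * (a + b - s) = s * t] for [S'].
    - At a singular crossing, the first two equations give [z] and [w] since
      [b] is invertible; the other two are then consequences of
      [s + t = a + b] ([alexander_crossing]). *)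

Set Implicit Arguments.
Unset Strict Implicit.
Unset Printing Implicit Defensive.

Import GRing.Theory.
Local Open Scope ring_scope.

Section LinearOperations.
Variables (R : comNzRingType) (X : lmodType R).
Implicit Types (x y z : X).

Definition linop (u v : R) x y : X := u *: x + v *: y.

Lemma linopC u v x y : linop u v x y = linop v u y x.
Proof. exact: addrC. Qed.

Lemma linop10 x y : linop 1 0 x y = x.
Proof. by rewrite /linop scale1r scale0r addr0. Qed.

Lemma linop01 x y : linop 0 1 x y = y.
Proof. by rewrite linopC linop10. Qed.

Lemma linop0r u x y : linop u 0 x y = u *: x.
Proof. by rewrite /linop scale0r addr0. Qed.

Lemma linop_diag u v x : linop u v x x = (u + v) *: x.
Proof. by rewrite /linop scalerDl. Qed.

Lemma linop_linop u v p q p' q' x y :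
  linop u v (linop p q x y) (linop p' q' x y) =
  linop (u * p + v * p') (u * q + v * q') x y.
Proof. by rewrite /linop !scalerDr !scalerA addrACA -!scalerDl. Qed.

(** The common shape of the nine exchange laws; the three hypotheses compare
    the coefficients of [x], [y] and [z]. *)
Lemma linop_exchange u1 v1 u2 v2 u3 v3 w1 r1 w2 r2 w3 r3 x y z :
    u1 * u2 = w1 * w2 -> u1 * v2 + v1 * v3 = r1 * w3 ->
    v1 * u3 = w1 * r2 + r1 * r3 ->
  linop u1 v1 (linop u2 v2 x y) (linop u3 v3 z y) =
  linop w1 r1 (linop w2 r2 x z) (linop w3 r3 y z).
Proof.
move=> ex ey ez; rewrite /linop !scalerDr !scalerA ex ez -ey !scalerDl.
by rewrite [LHS](AC (2*(2*1)) ((1*3)*((2*5)*4))).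
Qed.

Lemma bijective_linop u u' v y : u' * u = 1 -> bijective (linop u v ^~ y).
Proof.
move=> uK; exists (linop u' (- (u' * v)) ^~ y) => x; rewrite /linop.
  by rewrite scalerDr !scalerA uK scale1r scaleNr addrK.
by rewrite scalerDr !scalerA mulrN mulrA (mulrC u) uK !mul1r scale1r scaleNr subrK.
Qed.

(** The inverse is given by Cramer's rule, [d] being the inverse of the
    determinant up to sign. *)
Lemma bijective_linop_pair d u v p q : d * (u * p - v * q) = 1 ->
  bijective (fun xy : X * X => (linop u v xy.2 xy.1, linop p q xy.1 xy.2)).
Proof.
move=> dK.
exists (fun xy : X * X => (linop (- (d * q)) (d * u) xy.1 xy.2,
                           linop (d * p) (- (d * v)) xy.1 xy.2)).
  case=> x y /=; rewrite (linopC u) !linop_linop.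
  congr pair; [rewrite -[RHS](linop10 x y) | rewrite -[RHS](linop01 x y)];
    by congr linop; rewrite -?dK; ring.
case=> x y /=; rewrite (linopC u) !linop_linop.
congr pair; [rewrite -[RHS](linop10 x y) | rewrite -[RHS](linop01 x y)];
  by congr linop; rewrite -?dK; ring.
Qed.

Section Alexander.
Variables (t s a b t' s' a' b' : R).
Hypotheses (tK : t' * t = 1) (sK : s' * s = 1) (aK : a' * a = 1).
Hypotheses (bK : b' * b = 1) (relation : s + t = a + b).

Let bE : b = s + t - a.
Proof. by rewrite relation addrAC subrr add0r. Qed.

Lemma alexander_biquandle :
  is_biquandle (@linop t (s - t)) (@linop s 0).
Proof.
split=> [x|y|y||x y z|x y z|x y z].
- by rewrite !linop_diag; congr (_ *: _); ring.
- exact: bijective_linop sK.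
- exact: bijective_linop tK.
- apply: (@bijective_linop_pair (s' * t')).
  by rewrite mul0r subr0 mulrACA sK tK mulr1.
- by apply: linop_exchange; ring.
- by apply: linop_exchange; ring.
- by apply: linop_exchange; ring.
Qed.

(** Uniqueness comes from the first two equations alone: [z] and [w] each
    appear in one of them, under the injective map [linop b (s - b) ^~ c]. *)
Lemma alexander_crossing x y : exists! p : X * X,
  [/\ linop t (s - t) x y = linop b (s - b) p.2 y,
      linop s 0 y x = linop b (s - b) p.1 x,
      linop t (s - t) p.1 p.2 = linop a (s - a) y p.2 &
      linop s 0 p.2 p.1 = linop a (s - a) x p.1].
Proof.
(* The solutions of the first two equations: [b *: z = t *: x + (b - t) *: y]
   and [b *: w = s *: y + (b - s) *: x]. *)
pose z := linop (b' * t) (b' * (b - t)) x y.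
pose w := linop (b' * (b - s)) (b' * s) x y.
have zE : linop t (s - t) x y = linop b (s - b) z y.
  rewrite -[in RHS](linop01 x y) linop_linop.
  by congr linop; ring: bK.
have wE : linop s 0 y x = linop b (s - b) w x.
  rewrite linopC -[X in linop b _ _ X](linop10 x y) linop_linop.
  by congr linop; ring: bK.
exists (w, z); split=> [|[w1 z1] /= [z1E w1E _ _]]; last first.
  have inj c := bij_inj (@bijective_linop b b' (s - b) c bK).
  by congr pair; [apply: (inj x) | apply: (inj y)]; rewrite /= -?wE -?zE.
(* Eliminating [s] rather than [b] leaves [b' * b = 1] a rewriting rule on
   monomials. *)
have sE : s = a + b - t by rewrite -relation addrK.
split=> //=.
- rewrite -[X in _ = linop _ _ X _](linop01 x y) /w /z !linop_linop.
  by congr linop; rewrite sE; ring: bK.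
- rewrite -[X in _ = linop _ _ X _](linop10 x y) /w /z !linop_linop.
  by congr linop; rewrite sE; ring: bK.
Qed.

Lemma alexander_psyquandle :
  is_pI_adequate_psyquandle (@linop t (s - t)) (@linop s 0)
    (@linop a (s - a)) (@linop b (s - b)).
Proof.
split=> [|x]; last by rewrite !linop_diag; congr (_ *: _); ring.
split=> [|y|y||x y|x y z|x y z|x y z|x y z|x y z|x y z].
- exact: alexander_biquandle.
- exact: bijective_linop bK.
- exact: bijective_linop aK.
- apply: (@bijective_linop_pair (s' * t')).
  have -> : b * a - (s - b) * (s - a) = s * t by rewrite bE; ring.
  by rewrite mulrACA sK tK mulr1.
- exact: alexander_crossing.
all: by apply: linop_exchange; rewrite ?bE; ring.
Qed.

End Alexander.
End LinearOperations.

Theorem proposition5 (X : lmodType alexander_ring) :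
  is_pI_adequate_psyquandle
    (fun x y : X => alex_t *: x + (alex_s - alex_t) *: y)
    (fun x y : X => alex_s *: x)
    (fun x y : X => alex_a *: x + (alex_s - alex_a) *: y)
    (fun x y : X => alex_b *: x + (alex_s - alex_b) *: y).
Proof.
have -> : (fun x y : X => alex_s *: x) = linop alex_s 0.
  by apply/funext => x; apply/funext => y; rewrite linop0r.
have [t' tK] := alexander_var_inv (inord 0).
have [s' sK] := alexander_var_inv (inord 1).
have [a' aK] := alexander_var_inv (inord 2).
have [b' bK] := alexander_var_inv (inord 3).
exact: alexander_psyquandle tK sK aK bK alexander_relation.
Qed.
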